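(* Let $k\in\mathbb{N}$, $k\ge 1$. Let $(X,\mathbb{R}^k)$ be a topological multidimensional flow. If $\mathrm{Fix}(X,\mathbb{R}^k)$ embeds topologically into $[0,1]$ and $(X,\mathbb{R}^k)$ is weakly locally free, then $(X,\mathbb{R}^k)$ embeds into $\mathrm{Lip}_1(\mathbb{R}^k)$, that is, there exists a continuous injective $\mathbb{R}^k$-equivariant map $X\to \mathrm{Lip}_1(\mathbb{R}^k)$.
   Context: A topological multidimensional flow $(X,\mathbb{R}^k)$ is a compact metrizable space $X$ with a continuous action $\mathbb{R}^k\times X\to X$, $(\mathbf{t},x)\mapsto \mathbf{t}x$. Its fixed point set is $\mathrm{Fix}(X,\mathbb{R}^k)=\{x\in X:\mathbf{t}x=x\text{ for all }\mathbf{t}\in\mathbb{R}^k\}$. The flow is weakly locally free if for every $x\in X\setminus \mathrm{Fix}(X,\mathbb{R}^k)$ there is an open set $U_x\subset\mathbb{R}^k$ containing $\mathbf{0}$ such that $\mathbf{u}x\ne x$ for all $\mathbf{u}\in U_x\setminus\{\mathbf{0}\}$. $\mathrm{Lip}_1(\mathbb{R}^k)$ is the space of functions $f:\mathbb{R}^k\to[0,1]$ with $|f(\mathbf{s})-f(\mathbf{r})|\le\|\mathbf{s}-\mathbf{r}\|_2$ for all $\mathbf{s},\mathbf{r}\in\mathbb{R}^k$ (Euclidean norm), with the compact-open topology, which makes it a compact metrizable space. $\mathbb{R}^k$ acts on it by the shift $(\mathbf{t}\cdot f)(\mathbf{s})=f(\mathbf{s}+\mathbf{t})$. A topological embedding between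 compact metrizable spaces is a continuous injective map. *)

(* Defs.v *)
From HB Require Import structures.
From mathcomp Require Import all_boot all_order all_algebra.
From mathcomp Require Import all_classical all_reals all_analysis.

Set Implicit Arguments.
Unset Strict Implicit.
Unset Printing Implicit Defensive.

Import Order.TTheory GRing.Theory Num.Theory.
Import numFieldNormedType.Exports.

Local Open Scope classical_set_scope.
Local Open Scope ring_scope.

(* The metric is existentially quantified: the topology of [X] is given, and
   [d] is only required to induce it. *)
Definition metrizable (R : realType) (X : topologicalType) : Prop :=
  exists d : X -> X -> R,
    [/\ forall x y, (0 <= d x y) /\ (d x y = 0 <-> x = y),
        forall x y, d x y = d y x,
        forall x y z, d x z <= d x y + d y z &
        forall (x : X) (A : set X),
          nbhs x A <-> exists2 e : R, 0 < e & [set y | d x y < e] `<=` A].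

(* [act t x] is the point $\mathbf{t}x$; continuity is joint in [(t, x)]. *)
Definition multidimensional_flow (R : realType) (k : nat)
    (X : topologicalType) (act : 'rV[R]_k -> X -> X) : Prop :=
  [/\ compact [set: X],
      metrizable R X,
      continuous (fun p : 'rV[R]_k * X => act p.1 p.2),
      forall x, act 0 x = x &
      forall s t x, act (s + t) x = act s (act t x)].

Definition fixed_points (R : realType) (k : nat) (X : topologicalType)
    (act : 'rV[R]_k -> X -> X) : set X :=
  [set x | forall t, act t x = x].

Definition weakly_locally_free (R : realType) (k : nat) (X : topologicalType)
    (act : 'rV[R]_k -> X -> X) : Prop :=
  forall x, ~ fixed_points act x ->
    exists U : set 'rV[R]_k,
      [/\ open U, U 0 & forall u, U u -> u != 0 -> act u x <> x].

(* Used only between compact metrizable spaces, where a continuous injection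
   is automatically a homeomorphism onto its image. *)
Definition topological_embedding (X Y : topologicalType) (f : X -> Y) : Prop :=
  continuous f /\ injective f.

Definition embeds_topologically (X Y : topologicalType) : Prop :=
  exists f : X -> Y, topological_embedding f.

Definition flow_embeds (R : realType) (k : nat) (X Y : topologicalType)
    (actX : 'rV[R]_k -> X -> X) (actY : 'rV[R]_k -> Y -> Y) : Prop :=
  exists f : X -> Y,
    topological_embedding f /\ forall t x, f (actX t x) = actY t (f x).

(* The library norm on ['rV[R]_k] is the sup norm, hence this definition. *)
Definition norm2 (R : realType) (k : nat) (v : 'rV[R]_k) : R :=
  Num.sqrt (\sum_(i < k) v ord0 i ^+ 2).

(* Being declared as a set in the compact-open function space, its coercion to
   a type carries the induced compact-open topology. *)
Definition Lip1 (R : realType) (k : nat) :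
    set {compact-open, 'rV[R]_k -> R} :=
  [set f | (forall s, 0 <= f s <= 1) /\
           (forall s r, `|f s - f r| <= norm2 (s - r))].

Definition lip_shift_fun (R : realType) (k : nat) (t : 'rV[R]_k)
    (f : {compact-open, 'rV[R]_k -> R}) : {compact-open, 'rV[R]_k -> R} :=
  fun s => f (s + t).

Lemma lip_shift_fun_Lip1 (R : realType) (k : nat) (t : 'rV[R]_k)
    (f : set_type (@Lip1 R k)) :
  lip_shift_fun t (set_val f) \in @Lip1 R k.
Proof.
case: f => f /=; rewrite set_valE /= => /set_mem [f01 fL].
apply/mem_set; split=> [s|s r]; first exact: f01.
by have := fL (s + t) (r + t); rewrite opprD addrACA subrr addr0.
Qed.

Definition lip_shift (R : realType) (k : nat) (t : 'rV[R]_k)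
    (f : set_type (@Lip1 R k)) : set_type (@Lip1 R k) :=
  exist _ (lip_shift_fun t (set_val f)) (lip_shift_fun_Lip1 t f).

(* Main.v *)
Require Import Defs.
From mathcomp Require Import all_boot all_order all_algebra.
From mathcomp Require Import all_classical all_reals all_analysis.
From mathcomp Require Import ring lra.
Import Order.TTheory GRing.Theory Num.Theory.
Import numFieldNormedType.Exports.
Local Open Scope classical_set_scope.
Local Open Scope ring_scope.

Set Implicit Arguments.
Unset Strict Implicit.
Unset Printing Implicit Defensive.

(** A function [f : X -> [0, 1]] that is continuous and 1-Lipschitz along orbits
    gives the continuous equivariant map sending [x] to [s |-> f (s x)] into
    [Lip1]; this map is injective as soon as any two points of [X] have orbits
    on which [f] differs at some time ([orbit_map_embedding]).  Such an [f] is
    found by a Baire category argument among the functions with a prescribed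
    restriction to the fixed points.  The restriction is a rescaled embedding of
    the fixed points into [[0, 1]], so that pairs of fixed points are separated
    from the start ([fixed_points_separating]).  The remaining pairs form a
    countable union of compact sets, so it suffices that on a neighbourhood of
    each such pair separation can be achieved by an arbitrarily small change of
    [f], and is then stable under smaller changes ([local_separation],
    [separation_margin]).

    The heart is the local step.  Let [p] be a point that is not fixed and
    [q <> p].  All regularisation is done by the sup-convolution
    [sup_conv c F x = sup_t (F (t x) - c |t|)], which is [c]-Lipschitz along
    orbits, lies above [F], and does not change [F] at fixed points.  After a
    small change [f] is [1 - delta]-Lipschitz along orbits ([strict_approx]).
    Then let [w] be a function with values in [[0, 1]] that vanishes away from
    [p] and oscillates very fast along the orbits near [p], and put
    [g = sup_conv 1 (f + eps w)].  Near [q] the bump is too low and too far in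
    time to be felt, so [g = f] is [1 - delta]-Lipschitz along short orbit
    pieces.  Near [p] this is impossible: where the supremum defining [g] is
    attained at a nonzero time, [g] has slope exactly one, and if it is always
    attained at time zero, then [g = f + eps w], which changes by almost [eps]
    within an arbitrarily short time.  Hence no orbit starting near [p] shows the
    same values of [g] as an orbit starting near [q] ([marker_separates]).

    The oscillation is produced by composing the distance to [p] with a cosine
    wave of short wave length.  Some arbitrarily small time [u] moves [p], so the
    distance to [p] gains a definite amount during [u] on every orbit starting
    near [p], and therefore runs through many waves ([fast_wave]). *)

(** * Real functions of one variable *)

Section RealFunctions.
Variable R : realType.

Lemma nonexpansive_continuous (phi : R -> R) :
  (forall a b, `|phi a - phi b| <= `|a - b|) -> continuous phi.
Proof.
move=> phi_lip a; apply/cvgrPdist_lt => e e0; near=> b.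
apply: le_lt_trans (phi_lip a b) _.
by near: b; apply: (cvgrPdist_lt (id : R -> R) a).1.
Unshelve. all: by end_near. Qed.

Lemma nonexpansive_min (c a b : R) : `|Num.min a c - Num.min b c| <= `|a - b|.
Proof.
rewrite ler_norml; have := ler_norm (a - b); have := ler_norm (b - a).
rewrite distrC; case: (leP a c); case: (leP b c) => ? ? ? ?; apply/andP; split; lra.
Qed.

Definition clip (a : R) : R := Num.max 0 (Num.min a 1).

Lemma clip01 a : 0 <= clip a <= 1.
Proof. by rewrite le_max lexx ge_max ler01 ge_min lexx orbT. Qed.

Lemma clip_le0 a : a <= 0 -> clip a = 0.
Proof. by move=> a0; rewrite /clip max_l // ge_min a0. Qed.

Lemma clip_ge1 a : 1 <= a -> clip a = 1.
Proof. by move=> a1; rewrite /clip min_r // max_r. Qed.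

Lemma continuous_clip : continuous clip.
Proof.
apply: nonexpansive_continuous => a b; apply: le_trans (nonexpansive_min 1 a b).
rewrite /clip; move: (Num.min a 1) (Num.min b 1) => {}a {}b.
rewrite ler_norml; have := ler_norm (a - b); have := ler_norm (b - a).
rewrite distrC; case: (leP 0 a); case: (leP 0 b) => ? ? ? ?; apply/andP; split; lra.
Qed.

End RealFunctions.

(** * Rapid oscillation *)

Section FastWave.
Variable R : realType.

(** The [N] increments over steps of length [1 / N] telescope to at least [c]. *)
Lemma increment_pigeonhole (phi : R -> R) (c : R) (N : nat) : (0 < N)%N ->
  c <= phi 1 - phi 0 ->
  exists2 i : nat, (i < N)%N & c / N%:R <= phi (i.+1%:R / N%:R) - phi (i%:R / N%:R).
Proof.
move=> N0 cphi; apply: contrapT => H.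
have small (i : nat) : (i < N)%N ->
    phi (i.+1%:R / N%:R) - phi (i%:R / N%:R) < c / N%:R.
  by move=> iN; rewrite ltNge; apply/negP => h; apply: H; exists i.
have : \sum_(0 <= i < N) (phi (i.+1%:R / N%:R) - phi (i%:R / N%:R)) <
       \sum_(0 <= i < N) c / N%:R.
  rewrite !big_mkord; apply: ltr_sum; last by move=> i _; exact: small.
  by apply/hasP; exists (Ordinal N0); rewrite ?mem_index_enum.
rewrite (telescope_sumr (fun i => phi (i%:R / N%:R))) // divff ?mul0r; last first.
  by rewrite pnatr_eq0 -lt0n.
rewrite sumr_const_nat subn0 -(mulr_natr (c / N%:R)) divfK ?pnatr_eq0 -?lt0n //.
by rewrite ltNge cphi.
Qed.

Let continuous_wave (a : R) : continuous (fun x : R => (1 + cos (a * x)) / 2).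
Proof.
move=> x; apply: (@continuousM _ _ (fun x => 1 + cos (a * x)) (cst 2^-1)).
  2: exact: cst_continuous.
apply: (@continuousD _ R _ (cst 1) (fun x => cos (a * x))).
  exact: cst_continuous.
apply: (@continuous_comp _ _ _ (fun x : R => a * x)); last exact: continuous_cos.
exact: mulrl_continuous.
Qed.

(** A cosine wave of length [c / N] works, whatever [phi] is: during one of the [N]
    time steps [phi] gains at least [c / N], so it runs through a crest and
    through a trough of the wave within that step. *)
Lemma fast_wave (c : R) (N : nat) : 0 < c -> (0 < N)%N ->
  exists T : R -> R,
    [/\ continuous T, forall x, 0 <= T x <= 1 &
      forall phi : R -> R, continuous phi -> (forall x, 0 <= phi x) ->
        c <= phi 1 - phi 0 ->
        exists a b, [/\ 0 <= a <= 1, 0 <= b <= 1, `|a - b| <= N%:R^-1 &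
                        `|T (phi a) - T (phi b)| = 1] ].
Proof.
move=> c0 N0; have N0' : 0 < N%:R :> R by rewrite ltr0n.
pose h : R := c / N%:R / 2.
have h0 : 0 < h by rewrite !divr_gt0.
pose T x := (1 + cos (pi / h * x)) / 2 : R.
have T_multiple (m : nat) : T (h * m%:R) = (1 + (-1) ^+ m) / 2.
  rewrite /T mulrA divfK ?gt_eqF // mulr_natr -[pi *+ m]add0r.
  by rewrite (alternatingn (@cosDpi R)) cos0 mulr1.
exists T; split.
- exact: continuous_wave.
- move=> x; have := cos_geN1 (pi / h * x); have := cos_le1 (pi / h * x).
  by rewrite /T => ? ?; apply/andP; split; lra.
- move=> phi phiC phi0 cphi.
  have [i iN gain] := increment_pigeonhole N0 cphi.
  set u := i%:R / N%:R in gain; set v := i.+1%:R / N%:R in gain.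
  have uv : v - u = N%:R^-1 by rewrite /u /v -mulrBl -natrB // subSnn mul1r.
  have N1 : 0 < N%:R^-1 :> R by rewrite invr_gt0.
  have u_ge0 : 0 <= u by rewrite divr_ge0.
  have v_le1 : v <= 1 by rewrite ler_pdivrMr // mul1r ler_nat.
  have gain2 : h * 2 <= phi v - phi u by rewrite /h divfK.
  (* [h * m] and [h * m.+1] are consecutive extrema of the wave, and both are
     taken by [phi] between [u] and [v]. *)
  pose m := (Num.truncn (phi u / h)).+1.
  have /andP[m1 m2] : h * m.-1%:R <= phi u < h * m%:R.
    have := truncn_itv (divr_ge0 (phi0 u) (ltW h0)).
    by rewrite ler_pdivlMr // ltr_pdivrMr // !(mulrC _ h).
  have m3 : h * m%:R = h * m.-1%:R + h by rewrite /m -natr1 mulrDr mulr1.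
  have m4 : h * m.+1%:R = h * m%:R + h by rewrite -natr1 mulrDr mulr1.
  have reach y : phi u <= y <= phi v -> exists2 a, u <= a <= v & phi a = y.
    move=> yuv; have [|||a ain <-] := @IVT R phi u v y.
    - lra.
    - exact: continuous_subspaceT.
    - by rewrite min_l ?max_r //; lra.
    by exists a => //; move: ain; rewrite in_itv.
  have [|a /andP[ua av] phia] := reach (h * m%:R); first by apply/andP; split; lra.
  have [|b /andP[ub bv] phib] := reach (h * m.+1%:R).
    by apply/andP; split; lra.
  exists a, b; split; try by apply/andP; split; lra.
  + by rewrite -uv ler_norml; apply/andP; split; lra.
  + rewrite phia phib !T_multiple exprS -mulrBl.
    have -> : 1 + (-1) ^+ m - (1 + -1 * (-1) ^+ m) = 2 * (-1) ^+ m :> R by ring.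
    by rewrite mulrAC divff ?pnatr_eq0 // mul1r normrX normrN1 expr1n.
Qed.

End FastWave.

(** * The Euclidean norm *)

Section EuclideanNorm.
Variables (R : realType) (k : nat).
Implicit Types u v : 'rV[R]_k.

Let sumsq v : R := \sum_(i < k) v ord0 i ^+ 2.

Let sumsq_ge0 v : 0 <= sumsq v.
Proof. by apply: sumr_ge0 => i _; exact: sqr_ge0. Qed.

Let norm2_sqr v : norm2 v ^+ 2 = sumsq v.
Proof. by rewrite sqr_sqrtr ?sumsq_ge0. Qed.

Lemma norm2_ge0 v : 0 <= norm2 v.
Proof. exact: sqrtr_ge0. Qed.

Lemma norm2Z (a : R) v : norm2 (a *: v) = `|a| * norm2 v.
Proof.
rewrite /norm2 -sqrtr_sqr -sqrtrM ?sqr_ge0 // mulr_sumr; congr Num.sqrt.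
by apply: eq_bigr => i _; rewrite mxE exprMn.
Qed.

Lemma norm2_0 : norm2 (0 : 'rV[R]_k) = 0.
Proof. by rewrite -(scale0r (0 : 'rV[R]_k)) norm2Z normr0 mul0r. Qed.

Lemma norm2N v : norm2 (- v) = norm2 v.
Proof. by rewrite -scaleN1r norm2Z normrN1 mul1r. Qed.

Lemma norm2_coord v (i : 'I_k) : `|v ord0 i| <= norm2 v.
Proof.
rewrite -sqrtr_sqr ler_sqrt ?sumsq_ge0 //.
by rewrite (bigD1 i) //= lerDl; apply: sumr_ge0 => j _; exact: sqr_ge0.
Qed.

Lemma norm2_le0 v : norm2 v <= 0 -> v = 0.
Proof.
move=> v0; apply/rowP => i; rewrite mxE; apply/eqP; rewrite -normr_le0.
exact: le_trans (norm2_coord v i) v0.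
Qed.

(** The sum of squares of the coordinates of [norm2 v *: u - norm2 u *: v] is
    nonnegative. *)
Let cauchy_schwarz u v :
  \sum_(i < k) u ord0 i * v ord0 i <= norm2 u * norm2 v.
Proof.
have [u0|un0] := leP (norm2 u) 0.
  rewrite (norm2_le0 u0) norm2_0 mul0r big1 // => i _.
  by rewrite mxE mul0r.
have [v0|vn0] := leP (norm2 v) 0.
  rewrite (norm2_le0 v0) norm2_0 mulr0 big1 // => i _.
  by rewrite mxE mulr0.
have uv0 : 0 < norm2 u * norm2 v by rewrite mulr_gt0.
have := sumsq_ge0 (norm2 v *: u - norm2 u *: v).
have -> : sumsq (norm2 v *: u - norm2 u *: v) =
    norm2 v ^+ 2 * sumsq u + norm2 u ^+ 2 * sumsq v
    - 2 * (norm2 u * norm2 v) * \sum_(i < k) u ord0 i * v ord0 i.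
  rewrite /sumsq !mulr_sumr -big_split -sumrB; apply: eq_bigr => i _ /=.
  by rewrite !mxE; ring.
rewrite -!norm2_sqr => h.
rewrite -(ler_pM2l uv0); lra.
Qed.

Lemma norm2D u v : norm2 (u + v) <= norm2 u + norm2 v.
Proof.
rewrite -(@ler_pXn2r _ 2) ?nnegrE ?addr_ge0 ?norm2_ge0 // sqrrD !norm2_sqr.
have -> : sumsq (u + v) =
    sumsq u + (\sum_(i < k) u ord0 i * v ord0 i) *+ 2 + sumsq v.
  rewrite /sumsq -sumrMnl -!big_split; apply: eq_bigr => i _ /=.
  by rewrite !mxE sqrrD.
by rewrite lerD2r lerD2l lerMn2r cauchy_schwarz.
Qed.

Lemma continuous_norm2 : continuous (@norm2 R k).
Proof.
have sumsq_cont : continuous sumsq.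
  suff cont (r : seq 'I_k) :
    continuous (fun w : 'rV[R]_k => \sum_(i <- r) w ord0 i ^+ 2) by exact: cont.
  elim: r => [|i r IH].
    have -> : (fun w : 'rV[R]_k => \sum_(i <- [::]) w ord0 i ^+ 2) = cst 0.
      by apply/funext => w; rewrite big_nil.
    exact: cst_continuous.
  have -> : (fun w : 'rV[R]_k => \sum_(j <- i :: r) w ord0 j ^+ 2) =
      (fun w => w ord0 i ^+ 2 + \sum_(j <- r) w ord0 j ^+ 2).
    by apply/funext => w; rewrite big_cons.
  move=> v; apply: (@continuousD _ _ 'rV[R]_k); last exact: IH.
  apply: (@continuous_comp _ R R (fun w : 'rV[R]_k => w ord0 i)
    (fun x => x ^+ 2)); [exact: coord_continuous | exact: exprn_continuous].
move=> v; apply: (@continuous_comp _ R R sumsq).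
  exact: sumsq_cont.
exact: sqrt_continuous.
Qed.

Lemma compact_norm2_ball (M : R) : compact [set v : 'rV[R]_k | norm2 v <= M].
Proof.
have cB : compact [set v : 'rV[R]_k | forall i, `[- M, M]%classic (v ord0 i)].
  by apply: (@rV_compact R k (fun=> `[- M, M]%classic)) => i;
    exact: segment_compact.
have clB : closed [set v : 'rV[R]_k | norm2 v <= M].
  apply: (@closed_comp _ _ (@norm2 R k) [set x | x <= M]).
    by move=> x _; exact: continuous_norm2.
  exact: closed_le.
apply: subclosed_compact clB cB _ => v /= vM i.
by rewrite /= in_itv /= -ler_norml (le_trans (norm2_coord v i)).
Qed.

End EuclideanNorm.

(** * Induction over a compact set *)

(** If [P K] fails, the sets [S] such that [P (K `\` S)] form a proper filter
    on [K]; at a cluster point of it the local hypothesis is contradicted. *)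
Lemma compact_induction (T : topologicalType) (K : set T) (P : set T -> Prop) :
  compact K -> P set0 -> (forall A B, A `<=` B -> P B -> P A) ->
  (forall A B, P A -> P B -> P (A `|` B)) ->
  (forall x, K x -> exists2 W, nbhs x W & P W) -> P K.
Proof.
move=> cK P0 Psub PU Ploc; apply: contrapT => nPK.
pose F : set_system T := [set S | P (K `\` S)].
have FF : ProperFilter F.
  split; first by rewrite /F /= setD0.
  split.
  - by rewrite /F /= setDT.
  - move=> A B PA PB; suff : P (K `\` (A `&` B)) by [].
    by rewrite setDE setCI setIUr -!setDE; exact: PU.
  - by move=> A B AB; apply: Psub; exact: setDS.
have FK : F K by rewrite /F /= setDv.
have [x [Kx xF]] := cK F FF FK.
have [W xW PW] := Ploc x Kx.
have FW : F (~` W).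
  by apply: (Psub _ W) => // y [_ nnWy]; exact: contrapT.
by have [y [nWy Wy]] := xF _ _ FW xW.
Qed.

(** * Sup-convolution along orbits *)

Section FlowCalculus.
Variables (R : realType) (k : nat) (X : topologicalType).
Variable act : 'rV[R]_k -> X -> X.
Hypothesis actC : continuous (fun p : 'rV[R]_k * X => act p.1 p.2).
Hypothesis act0 : forall x, act 0 x = x.
Hypothesis actD : forall s t x, act (s + t) x = act s (act t x).

Lemma continuous_act_swap : continuous (fun q : X * 'rV[R]_k => act q.2 q.1).
Proof.
move=> [x t] A At; have [[P Q] /= [Pt Qx] PQ] := @actC (t, x) A At.
by exists (Q, P) => //= -[y s] /= [Qy Ps]; exact: (PQ (s, y)).
Qed.

Lemma continuous_act_time x : continuous (fun t => act t x).
Proof.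
by move=> t; have [_ h] := continuous_curry continuous_act_swap; exact: (h x t).
Qed.

Lemma continuous_act_point t : continuous (act t).
Proof. by move=> x; have [_ h] := continuous_curry actC; exact: (h t x). Qed.

Definition orbit_lipschitz (c : R) (f : X -> R) : Prop :=
  forall t x, `|f (act t x) - f x| <= c * norm2 t.

Lemma orbit_lipschitz_le c f t x : orbit_lipschitz c f ->
  f (act t x) <= f x + c * norm2 t.
Proof. by move=> /(_ t x); rewrite ler_norml => /andP[_]; rewrite lerBlDl. Qed.

Lemma orbit_lipschitz2 c f s t x : orbit_lipschitz c f ->
  `|f (act s x) - f (act t x)| <= c * norm2 (s - t).
Proof. by move=> /(_ (s - t) (act t x)); rewrite -actD subrK. Qed.

(** The least function above [F] that is [c]-Lipschitz along orbits, for
    bounded [F] and [c > 0]. *)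
Definition sup_conv (c : R) (F : X -> R) (x : X) : R :=
  sup (range (fun t => F (act t x) - c * norm2 t)).

Section SupConvolution.
Variables (c : R) (F : X -> R).
Hypotheses (c_gt0 : 0 < c) (F_cont : continuous F).
Hypothesis F01 : forall x, 0 <= F x <= 1.

Let F_ge0 x : 0 <= F x. Proof. by case/andP: (F01 x). Qed.
Let F_le1 x : F x <= 1. Proof. by case/andP: (F01 x). Qed.

(** For [F] with values in [[0, 1]], a time of norm above [1 / c] gives a
    negative value and cannot compete with time [0]; the remaining times form a
    compact ball. *)
Lemma sup_conv_attained x :
  exists2 t, sup_conv c F x = F (act t x) - c * norm2 t & norm2 t <= c^-1.
Proof.
have cont : continuous (fun t => F (act t x) - c * norm2 t).
  move=> t; apply: (@continuousB _ _ 'rV[R]_k).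
    apply: (@continuous_comp _ _ _ (fun t => act t x)); last exact: F_cont.
    exact: continuous_act_time.
  apply: (@continuousM _ 'rV[R]_k); first exact: cst_continuous.
  exact: continuous_norm2.
have [||t] := @EVT_max_rV _ _ (fun t => F (act t x) - c * norm2 t) _ _
    (@compact_norm2_ball R k c^-1).
- by exists 0; rewrite /= norm2_0 invr_ge0 ltW.
- exact: continuous_subspaceT.
rewrite inE /= => tc tmax; exists t => //.
suff ub s : F (act s x) - c * norm2 s <= F (act t x) - c * norm2 t.
  apply/eqP; rewrite eq_le; apply/andP; split.
    by apply: ge_sup => [|_ [s _ <-]]; [exists (F (act t x) - c * norm2 t), t|].
  apply: ub_le_sup; last by exists t.
  by exists (F (act t x) - c * norm2 t) => _ [s _ <-].
have [sc|sc] := leP (norm2 s) c^-1; first by apply: tmax; rewrite inE.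
have /tmax : (0 : 'rV[R]_k) \in [set v | norm2 v <= c^-1].
  by rewrite inE /= norm2_0 invr_ge0 ltW.
rewrite norm2_0 mulr0 subr0 act0; apply: le_trans.
apply: le_trans (F_ge0 x); rewrite subr_le0 (le_trans (F_le1 _)) //.
by rewrite -ler_pdivrMl // mulr1 ltW.
Qed.

Lemma sup_conv_ge t x : F (act t x) - c * norm2 t <= sup_conv c F x.
Proof.
apply: ub_le_sup; last by exists t.
exists 1 => _ [s _ <-]; rewrite lerBlDr (le_trans (F_le1 _)) // lerDl.
by rewrite mulr_ge0 ?norm2_ge0 // ltW.
Qed.

Lemma sup_conv_above x : F x <= sup_conv c F x.
Proof. by have := sup_conv_ge 0 x; rewrite act0 norm2_0 mulr0 subr0. Qed.

Lemma sup_conv_ub (M : R) x : (forall y, F y <= M) -> sup_conv c F x <= M.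
Proof.
move=> FM; have [t -> _] := sup_conv_attained x.
by rewrite lerBlDr (le_trans (FM _)) // lerDl mulr_ge0 ?norm2_ge0 // ltW.
Qed.

Lemma sup_conv_fixed x : fixed_points act x -> sup_conv c F x = F x.
Proof.
move=> fx; apply/eqP; rewrite eq_le sup_conv_above andbT.
have [t -> _] := sup_conv_attained x.
by rewrite fx lerBlDr lerDl mulr_ge0 ?norm2_ge0 // ltW.
Qed.

Lemma sup_conv_lipschitz : orbit_lipschitz c (sup_conv c F).
Proof.
suff le1 t x : sup_conv c F (act t x) - sup_conv c F x <= c * norm2 t.
  move=> t x; rewrite ler_norml le1 andbT.
  have := le1 (- t) (act t x).
  by rewrite -actD addNr act0 norm2N lerNl opprB.
have [s -> _] := sup_conv_attained (act t x).
rewrite -actD; have := sup_conv_ge (s + t) x.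
have : c * norm2 (s + t) <= c * norm2 s + c * norm2 t.
  by rewrite -mulrDr ler_pM2l // norm2D.
lra.
Qed.

(** Only the times in a fixed compact ball compete for the supremum, and over
    them the functions [F \o act t] are equicontinuous at every point. *)
Lemma continuous_sup_conv : continuous (sup_conv c F).
Proof.
move=> x; apply/cvgrPdist_le => e e0.
have near_ball : \forall y \near x, [set t | norm2 t <= c^-1] `<=`
    (fun t => `|F (act t x) - F (act t y)| <= e).
  have /compact_near_coveringP cov := @compact_norm2_ball R k c^-1.
  apply: (cov X (nbhs x) (fun y t => `|F (act t x) - F (act t y)| <= e)) => t _.
  have FC : continuous (fun p : 'rV[R]_k * X => F (act p.1 p.2)).
    by move=> p; apply: continuous_comp; [exact: actC | exact: F_cont].
  have /cvgrPdist_le /(_ (e / 2)) := FC (t, x).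
  have e2 : 0 < e / 2 by rewrite divr_gt0.
  move=> /(_ e2) [[A B] /= [At Bx] AB].
  exists (A, B) => //= -[s y] /= [As By].
  have := AB (s, y) (conj As By); have := AB (s, x) (conj As (nbhs_singleton Bx)).
  move=> /= h1 h2.
  rewrite (le_trans (ler_distD (F (act t x)) _ _)) // (splitr e) lerD //.
  by rewrite distrC.
near=> y.
have close : [set t | norm2 t <= c^-1] `<=`
    (fun t => `|F (act t x) - F (act t y)| <= e) by near: y; exact: near_ball.
rewrite ler_norml.
have [s sE sc] := sup_conv_attained x; have [t tE tc] := sup_conv_attained y.
have := sup_conv_ge s y; have := sup_conv_ge t x.
have := close s sc; have := close t tc; rewrite !ler_norml.
move=> /andP[? ?] /andP[? ?] ? ?; apply/andP; split; lra.
Unshelve. all: by end_near. Qed.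

End SupConvolution.

(** * The fast oscillating marker *)

Definition marked (f w : X -> R) (eps : R) (x : X) : R := f x + eps * w x.

Section Marker.
Variables (f w : X -> R) (delta eps r : R).
Hypothesis delta_gt0 : 0 < delta.
Hypotheses (eps_gt0 : 0 < eps) (eps_small : eps < delta * (r / 2)).
Hypotheses (f_cont : continuous f) (w_cont : continuous w).
Hypothesis f01 : forall x, 0 <= f x <= 1 - eps.
Hypothesis w01 : forall x, 0 <= w x <= 1.
Hypothesis f_lip : orbit_lipschitz (1 - delta) f.

Local Notation F := (marked f w eps).
Local Notation g := (sup_conv 1 F).

Lemma continuous_marker : continuous F.
Proof.
move=> x; rewrite /marked.
apply: (@continuousD _ R _ f (fun x => eps * w x)); first exact: f_cont.
by apply: (@continuousM _ _ (cst eps) w); [exact: cst_continuous | exact: w_cont].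
Qed.

Let w_ge0 x : 0 <= w x. Proof. by case/andP: (w01 x). Qed.

Let F_le x : F x <= f x + eps.
Proof. by rewrite lerD2l ler_piMr ?(ltW eps_gt0) //; case/andP: (w01 x). Qed.

Let F_ge x : f x <= F x.
Proof. by rewrite lerDl mulr_ge0 // ltW. Qed.

Lemma marker01 x : 0 <= F x <= 1.
Proof.
have /andP[f0 f1] := f01 x; rewrite (le_trans f0 (F_ge x)) /=.
by apply: le_trans (F_le x) _; rewrite -lerBrDr.
Qed.

Let attained x := sup_conv_attained ltr01 continuous_marker marker01 x.
Let g_geF x : F x <= g x := sup_conv_above ltr01 marker01 x.

Let far t x : delta * norm2 t > eps -> F (act t x) - norm2 t < f x.
Proof.
move=> td; have := orbit_lipschitz_le t x f_lip; have := F_le (act t x).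
by rewrite mulrBl mul1r; lra.
Qed.

Lemma marker_close x : f x <= g x <= f x + eps.
Proof.
rewrite (le_trans (F_ge x) (g_geF x)) /=.
have [t -> _] := attained x; rewrite mul1r.
have := orbit_lipschitz_le t x f_lip; have := F_le (act t x).
have := mulr_ge0 (ltW delta_gt0) (norm2_ge0 t).
by rewrite mulrBl mul1r; lra.
Qed.

(** A time [t] at which the bump is met has [norm2 t > r]; reaching it costs
    [delta * r] more than [f] can gain on the way, which exceeds the height
    [eps] of the bump. *)
Lemma marker_off y : (forall s, norm2 s <= r -> w (act s y) = 0) -> g y = f y.
Proof.
move=> w0; apply/eqP; rewrite eq_le (andP (marker_close y)).1 andbT.
have [t -> _] := attained y; rewrite mul1r.
have [tr|tr] := leP (norm2 t) r.
  rewrite /marked w0 // mulr0 addr0; have := orbit_lipschitz_le t y f_lip.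
  have := mulr_ge0 (ltW delta_gt0) (norm2_ge0 t).
  by rewrite mulrBl mul1r; lra.
apply/ltW/far; apply: lt_trans eps_small _; rewrite ltr_pM2l //.
have := norm2_ge0 t; lra.
Qed.

(** If the supremum at [x] is attained at a time [t <> 0], then [g] rises with
    slope one from [x] to [act t x], against the slope bound.  The bound is only
    needed for short times, since a long one is too expensive to attain the
    supremum. *)
Lemma marker_on x :
  (forall t, norm2 t <= r / 2 -> g (act t x) <= g x + (1 - delta) * norm2 t) ->
  g x = F x.
Proof.
move=> slope; have [t gE _] := attained x; rewrite mul1r in gE.
have [tr|tr] := leP (norm2 t) (r / 2); last first.
  have : F (act t x) - norm2 t < f x.
    by apply: far; rewrite (lt_trans eps_small) // ltr_pM2l.
  rewrite -gE => /lt_le_trans /(_ (F_ge x)) /lt_le_trans /(_ (g_geF x)).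
  by rewrite ltxx.
have t0 : norm2 t <= 0.
  have := slope t tr; have := g_geF (act t x); rewrite mulrBl mul1r => h1 h2.
  by rewrite -(pmulr_rle0 _ delta_gt0); lra.
by rewrite gE (norm2_le0 t0) act0 norm2_0 subr0.
Qed.

(** If [g] were the same along both orbits, the slope bound [1 - delta] near [y]
    would pass to the orbit of [x] and force [g = F] there by [marker_on].  But
    between the times [s] and [s'] the bump changes by [eps], while [g] and [f]
    each change by at most [eps / 3]. *)
Lemma marker_separates x y :
  (forall s, norm2 s <= r + r -> w (act s y) = 0) ->
  (exists s s', [/\ norm2 s <= r / 2, norm2 s' <= r / 2,
     norm2 (s - s') <= eps / 3 & `|w (act s x) - w (act s' x)| = 1]) ->
  exists t, g (act t x) <> g (act t y).
Proof.
move=> wy [s [s' [sr s'r ss' ww']]]; apply: contrapT => same.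
have gE t : g (act t x) = g (act t y).
  by apply: contrapT => neq; apply: same; exists t.
have gy t : norm2 t <= r -> g (act t y) = f (act t y).
  move=> tr; apply: marker_off => u ur; rewrite -actD wy //.
  by rewrite (le_trans (norm2D _ _)) // lerD.
have lip t t' : norm2 t <= r -> norm2 t' <= r ->
    `|g (act t x) - g (act t' x)| <= (1 - delta) * norm2 (t - t').
  by move=> tr t'r; rewrite !gE !gy //; exact: orbit_lipschitz2.
have gF t : norm2 t <= r / 2 -> g (act t x) = F (act t x).
  move=> tr; apply: marker_on => u ur; have r0 := le_trans (norm2_ge0 u) ur.
  have := lip (u + t) t; rewrite addrK -actD ler_norml.
  rewrite (le_trans (norm2D _ _)) //; last by lra.
  have -> : norm2 t <= r by lra.
  by move=> /(_ isT isT) /andP[_]; rewrite lerBlDl.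
have r0 := le_trans (norm2_ge0 s) sr.
have h1 : `|F (act s x) - F (act s' x)| <= (1 - delta) * norm2 (s - s').
  by rewrite -!gF // lip //; lra.
have h2 := orbit_lipschitz2 s s' x f_lip.
have h3 : (1 - delta) * norm2 (s - s') <= eps / 3.
  apply: le_trans ss'; by rewrite ler_piMl ?norm2_ge0 // gerBl ltW.
have e3 : eps <= eps / 3 + eps / 3.
  have {1}<- : `|eps * w (act s x) - eps * w (act s' x)| = eps.
    by rewrite -mulrBr normrM ww' mulr1 gtr0_norm.
  have -> : eps * w (act s x) - eps * w (act s' x) =
    (F (act s x) - F (act s' x)) - (f (act s x) - f (act s' x)).
    by rewrite /marked; ring.
  apply: le_trans (ler_normB _ _) _.
  by apply: lerD; [exact: le_trans h1 h3 | exact: le_trans h2 h3].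
by move: eps_gt0 e3; lra.
Qed.

End Marker.

(** * Separating two points by a small perturbation *)

Section Admissible.
Variable h : X -> R.
Hypothesis h_le : forall x, fixed_points act x -> h x <= 2^-1.

Definition admissible (f : X -> R) : Prop :=
  [/\ continuous f, forall x, 0 <= f x <= 1, orbit_lipschitz 1 f &
      forall x, fixed_points act x -> f x = h x].

(** Truncating [f] at [1 - e] makes room for a bump on top of it, and a
    sup-convolution of slope [1 - e] makes room for a strictly steeper slope.
    The truncation does not reach the fixed points, where the value is at most
    [1 / 2]. *)
Lemma strict_approx (f : X -> R) (e : R) : admissible f -> 0 < e <= 4^-1 ->
  exists g : X -> R, [/\ continuous g, forall x, 0 <= g x <= 1 - e,
    orbit_lipschitz (1 - e) g, forall x, fixed_points act x -> g x = h x &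
    forall x, `|f x - g x| <= 2 * e].
Proof.
move=> [fC f01 f_lip f_fix] /andP[e0 e4].
pose F x := Num.min (f x) (1 - e).
have c0 : 0 < 1 - e by lra.
have FC : continuous F.
  move=> x; apply: (@continuous_comp _ _ _ f (fun a => Num.min a (1 - e))).
    exact: fC.
  by apply: nonexpansive_continuous => a b; exact: nonexpansive_min.
have F_lip : orbit_lipschitz 1 F.
  by move=> t x; apply: le_trans (nonexpansive_min _ _ _) (f_lip t x).
have Ff x : f x - e <= F x <= f x.
  have /andP[? ?] := f01 x.
  by rewrite /F; case: (leP (f x) (1 - e)) => ?; apply/andP; split; lra.
have F_ub x : F x <= 1 - e by rewrite /F ge_min lexx orbT.
have F_ge0 x : 0 <= F x.
  by rewrite /F le_min (andP (f01 x)).1 /= ltW.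
have F01 x : 0 <= F x <= 1 by rewrite F_ge0 (le_trans (F_ub x)) // gerBl ltW.
exists (sup_conv (1 - e) F); split.
- exact: continuous_sup_conv.
- move=> x; rewrite (le_trans (F_ge0 x)) ?sup_conv_above //=.
  exact: sup_conv_ub.
- exact: sup_conv_lipschitz.
- move=> x fx; rewrite sup_conv_fixed // /F f_fix // min_l //.
  by have := h_le fx; lra.
- move=> x; have := sup_conv_above c0 F01 x; have /andP[? ?] := Ff x.
  have [t -> tc] := sup_conv_attained c0 FC F01 x.
  have := orbit_lipschitz_le t x F_lip; rewrite mul1r mulrBl mul1r => ? ?.
  have t2 : norm2 t <= 2.
    apply: le_trans tc _; rewrite -[leRHS]invrK lef_pV2 ?posrE //; lra.
  have et : e * norm2 t <= 2 * e by rewrite mulrC ler_pM2r.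
  by rewrite ler_norml; apply/andP; split; lra.
Qed.

Section Metric.
Variable d : X -> X -> R.
Hypothesis d_ge0 : forall x y, 0 <= d x y.
Hypothesis d_eq0 : forall x y, d x y = 0 <-> x = y.
Hypothesis d_sym : forall x y, d x y = d y x.
Hypothesis d_tri : forall x y z, d x z <= d x y + d y z.
Hypothesis d_nbhs : forall (x : X) (A : set X),
  nbhs x A <-> exists2 e : R, 0 < e & [set y | d x y < e] `<=` A.

Lemma nbhs_dist x e : 0 < e -> nbhs x [set y | d x y < e].
Proof. by move=> e0; apply/d_nbhs; exists e. Qed.

Lemma nbhs_dist_le x A : nbhs x A ->
  exists2 a : R, 0 < a & forall y, d x y <= a -> A y.
Proof.
move=> /d_nbhs[e e0 eA]; exists (e / 2) => [|y ye]; first by rewrite divr_gt0.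
apply: eA => /=; lra.
Qed.

Lemma dist_gt0 x y : x <> y -> 0 < d x y.
Proof. by move=> xy; rewrite lt_neqAle d_ge0 andbT eq_sym; apply/eqP => /d_eq0. Qed.

Lemma continuous_dist p : continuous (d p).
Proof.
move=> x; apply/cvgrPdist_lt => e e0; apply: filterS (nbhs_dist x e0) => y /= xy.
have := d_tri p x y; have := d_tri p y x; rewrite (d_sym y x) => ? ?.
by rewrite ltr_norml; apply/andP; split; lra.
Qed.

(** The fixed points form a closed set; the distance form is the one used to
    cut off a bump before it meets them. *)
Lemma nonfixed_dist p : ~ fixed_points act p ->
  exists2 e : R, 0 < e & forall z, fixed_points act z -> e <= d p z.
Proof.
move=> /existsNP[t tp]; pose a := d (act t p) p / 2.
have a0 : 0 < a by rewrite divr_gt0 // dist_gt0.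
have : nbhs p [set z | act t z <> z].
  have near1 : nbhs p [set z | d p z < a] by exact: nbhs_dist.
  have near2 : nbhs p [set z | d (act t p) (act t z) < a].
    exact: (@continuous_act_point t p _ (nbhs_dist (act t p) a0)).
  apply: filterS2 near1 near2 => z /= pz tz tzz; move: tz; rewrite tzz.
  have := d_tri (act t p) z p; rewrite (d_sym z p) /a in pz *; rewrite /a; lra.
move=> /d_nbhs[e e0 eA]; exists e => // z fz; rewrite leNgt; apply/negP => pz.
exact: (eA z pz (fz t)).
Qed.

(** The small times generate the group of all times, so if they all fixed [p]
    then [p] would be a fixed point. *)
Lemma small_mover p r : ~ fixed_points act p -> 0 < r ->
  exists2 u, norm2 u <= r & act u p <> p.
Proof.
move=> nfp r0; apply: contrapT => H; apply: nfp => t.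
have small u : norm2 u <= r -> act u p = p.
  by move=> ur; apply: contrapT => up; apply: H; exists u.
pose n := (Num.truncn (norm2 t / r)).+1.
have n0 : n%:R != 0 :> R by rewrite pnatr_eq0.
have -> : t = (n%:R^-1 *: t) *+ n by rewrite -scaler_nat scalerA divff ?scale1r.
have tn : act (n%:R^-1 *: t) p = p.
  apply: small; rewrite norm2Z ger0_norm ?invr_ge0 //.
  rewrite mulrC ler_pdivrMr ?ltr0n // mulrC -ler_pdivrMr //.
  by rewrite ltW // truncnS_gt.
move: (_ *: t) tn => v vp.
by elim: (n) => [|m IH]; rewrite ?mulr0n ?act0 // mulrS actD IH.
Qed.

Lemma nbhs_short_times p A : nbhs p A -> exists r a : R, [/\ 0 < r, 0 < a &
  forall s x, norm2 s <= r -> d p x <= a -> A (act s x)].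
Proof.
move=> pA; have pA' : nbhs (act 0 p) A by rewrite act0.
have [[P Q] /= [P0 Qp] PQ] := @actC (0 : 'rV[R]_k, p) A pA'.
have [a a0 aQ] := nbhs_dist_le Qp.
have /nbhs_ballP[e /= e0 eP] := P0.
exists (e / 2), a; split => //; first by rewrite divr_gt0.
move=> s x sr xa; apply: (PQ (s, x)); split => /=; last exact: aQ.
apply: eP; split => // i j; rewrite /ball /= (ord1 i) mxE sub0r normrN.
by apply: le_lt_trans (norm2_coord s j) _; lra.
Qed.

(** The radius [a] depends on [p] and [q] only, not on [f] or [e], so one
    neighbourhood of [(p, q)] serves for all perturbations. *)
Lemma local_separation p q : ~ fixed_points act p -> p <> q ->
  exists2 a : R, 0 < a & forall (f : X -> R) (e : R), admissible f -> 0 < e ->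
    exists g : X -> R, [/\ admissible g, forall x, `|f x - g x| <= e &
      forall x y, d p x <= a -> d q y <= a ->
        exists t, g (act t x) <> g (act t y)].
Proof.
move=> nfp pq; have [e1 e1_gt0 e1P] := nonfixed_dist nfp.
have pq0 := dist_gt0 pq.
(* The bump lives in the ball of radius [2 * b] around [p], which misses the
   fixed points and the ball of radius [b] around [q]. *)
pose b := Num.min e1 (d p q) / 4.
have m0 : 0 < Num.min e1 (d p q) by rewrite lt_min e1_gt0.
have b0 : 0 < b by rewrite divr_gt0.
have [be1 bpq] : 4 * b <= e1 /\ 4 * b <= d p q.
  by split; rewrite /b mulrC divfK // ge_min lexx ?orbT.
have [r1 [a1 [r1_gt0 a1_gt0 near_p]]] := nbhs_short_times (nbhs_dist p b0).
have [r2 [a2 [r2_gt0 a2_gt0 near_q]]] := nbhs_short_times (nbhs_dist q b0).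
pose r := Num.min r1 r2 / 2.
have r0 : 0 < r by rewrite divr_gt0 // lt_min r1_gt0.
have [rr1 rr2] : r + r <= r1 /\ r + r <= r2.
  by split; rewrite /r -splitr ge_min lexx ?orbT.
have [u ur up] : exists2 u, norm2 u <= r / 2 & act u p <> p.
  by apply: small_mover => //; rewrite divr_gt0.
(* Near [p] the distance to [p] is at most [c] at time [0] and at least [2 * c]
   at time [u]. *)
pose c := d p (act u p) / 3.
have c0 : 0 < c by rewrite divr_gt0 // dist_gt0 // => /esym.
have [a3 a3_gt0 near_u] : exists2 a : R, 0 < a &
    forall x, d p x <= a -> d (act u p) (act u x) < c.
  apply: nbhs_dist_le.
  exact: (@continuous_act_point u p _ (nbhs_dist (act u p) c0)).
pose a := Num.min (Num.min a1 a2) (Num.min a3 c).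
have [[aa1 aa2] [aa3 ac]] : (a <= a1 /\ a <= a2) /\ (a <= a3 /\ a <= c).
  by rewrite /a; do !split; rewrite !ge_min lexx ?orbT.
exists a; first by rewrite !lt_min a1_gt0 a2_gt0 a3_gt0.
move=> f e f_adm e0.
(* The truncation and the sup-convolution cost [2 * e'], the bump at most
   [e']. *)
pose e' := Num.min e 1 / 4.
have e'0 : 0 < e' by rewrite divr_gt0 // lt_min e0 ltr01.
have [e'e e'1] : 4 * e' <= e /\ 4 * e' <= 1.
  by split; rewrite /e' mulrC divfK // ge_min lexx ?orbT.
have e'4 : 0 < e' <= 4^-1 by rewrite e'0 /=; lra.
have [f1 [f1C f1_01 f1_lip f1_fix f1_close]] := strict_approx f_adm e'4.
pose eps := Num.min e' (e' * (r / 4)).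
have eps0 : 0 < eps by rewrite lt_min e'0 /= mulr_gt0 // divr_gt0.
have epse' : eps <= e' by rewrite ge_min lexx.
have eps_small : eps < e' * (r / 2).
  have : eps <= e' * (r / 4) by rewrite ge_min lexx orbT.
  have := mulr_gt0 e'0 r0; rewrite !mulrA => ? ?; lra.
(* One of [N] equal steps of the time [u] has length at most [eps / 3]. *)
pose N := (Num.truncn (norm2 u / (eps / 3))).+1.
have N0 : 0 < N%:R :> R by rewrite ltr0n.
have uN : N%:R^-1 * norm2 u <= eps / 3.
  rewrite mulrC ler_pdivrMr // mulrC -ler_pdivrMr ?divr_gt0 //.
  by rewrite ltW // truncnS_gt.
have [T [T_cont T01 T_osc]] := @fast_wave R c N c0 isT.
pose w x := clip (2 - d p x / b) * T (d p x).
have wC : continuous w.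
  move=> x; apply: (@continuousM _ _ (fun x => clip (2 - d p x / b))
                                     (fun x => T (d p x))); last first.
    by apply: (@continuous_comp _ _ _ (d p) T);
      [exact: continuous_dist | exact: T_cont].
  apply: (@continuous_comp _ _ _ (fun x => 2 - d p x / b) (@clip R)); last first.
    exact: continuous_clip.
  apply: (@continuousB _ R _ (cst 2) (fun x => d p x / b)).
    exact: cst_continuous.
  apply: (@continuousM _ _ (d p) (cst b^-1)); first exact: continuous_dist.
  exact: cst_continuous.
have w01 x : 0 <= w x <= 1.
  have /andP[? ?] := T01 (d p x); have /andP[? ?] := clip01 (2 - d p x / b).
  by rewrite mulr_ge0 //= mulr_ile1.
have w_far x : 2 * b <= d p x -> w x = 0.
  by move=> bx; rewrite /w clip_le0 ?mul0r // subr_le0 ler_pdivlMr.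
have w_near x : d p x <= b -> w x = T (d p x).
  move=> bx; rewrite /w clip_ge1 ?mul1r //.
  have : d p x / b <= 1 by rewrite ler_pdivrMr // mul1r.
  lra.
have w_fix x : fixed_points act x -> w x = 0.
  by move=> /e1P ?; apply: w_far; lra.
have f1_01' x : 0 <= f1 x <= 1 - eps.
  by have /andP[-> ?] := f1_01 x; rewrite /=; lra.
have FC := continuous_marker f1C wC (eps := eps).
have F01 := marker01 eps0 f1_01' w01.
pose g := sup_conv 1 (marked f1 w eps).
have g_close x : f1 x <= g x <= f1 x + eps.
  exact: marker_close e'0 eps0 f1C wC f1_01' w01 f1_lip x.
exists g; split.
- split.
  + exact: continuous_sup_conv.
  + move=> x; have /andP[? ?] := f1_01' x; have /andP[? ?] := g_close x.
    by apply/andP; split; lra.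
  + exact: sup_conv_lipschitz.
  + by move=> x fx; rewrite /g sup_conv_fixed // /marked w_fix // mulr0 addr0 f1_fix.
- move=> x; have := f1_close x; have /andP[? ?] := g_close x.
  by rewrite !ler_norml => /andP[? ?]; apply/andP; split; lra.
- move=> x y px qy.
  apply: (marker_separates e'0 eps0 eps_small f1C wC f1_01' w01 f1_lip).
    move=> s sr; apply: w_far.
    have /= := near_q s y (le_trans sr rr2) (le_trans qy aa2).
    by have := d_tri p (act s y) q; rewrite (d_sym (act s y) q); lra.
  have phiC : continuous (fun t : R => d p (act (t *: u) x)).
    move=> t; apply: (@continuous_comp _ _ _ (fun t : R => act (t *: u) x) (d p)).
      apply: (@continuous_comp _ _ _ (fun t : R => t *: u) (fun s => act s x)).
        exact: scalel_continuous.
      exact: continuous_act_time.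
    exact: continuous_dist.
  have [| | |t1 [t2 [t1_01 t2_01 t12 osc]]] := T_osc (fun t => d p (act (t *: u) x)).
  + exact: phiC.
  + by move=> t.
  + rewrite scale0r scale1r act0.
    have := near_u x (le_trans px aa3).
    have := d_tri p (act u x) (act u p).
    rewrite (d_sym (act u x) (act u p)) /c in ac *; rewrite /c; lra.
  have short t : 0 <= t <= 1 -> norm2 (t *: u) <= r / 2.
    move=> /andP[t0 t_le1]; rewrite norm2Z ger0_norm //.
    by apply: le_trans ur; rewrite ler_piMl ?norm2_ge0.
  have at_x t : 0 <= t <= 1 -> w (act (t *: u) x) = T (d p (act (t *: u) x)).
    move=> /short tr; apply/w_near/ltW/near_p; last exact: le_trans px aa1.
    by apply: le_trans tr _; lra.
  exists (t1 *: u), (t2 *: u); split; [exact: short | exact: short | | ].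
    rewrite -scalerBl norm2Z; apply: le_trans uN.
    by rewrite ler_wpM2r ?norm2_ge0.
  by rewrite !at_x.
Qed.

(** * Robust separation of compact sets of pairs *)

Definition separates (W : set (X * X)) (f : X -> R) : Prop :=
  forall p, W p -> exists t, f (act t p.1) <> f (act t p.2).

(** On a compact set of pairs the times can be chosen so that the difference of
    the two values is bounded away from zero. *)
Lemma separation_margin (K : set (X * X)) (f : X -> R) :
  compact K -> continuous f -> separates K f ->
  exists2 m : R, 0 < m &
    forall g, (forall x, `|f x - g x| <= m) -> separates K g.
Proof.
move=> /compact_near_coveringP cK fC sepf.
pose gap t (p : X * X) := `|f (act t p.1) - f (act t p.2)|.
have gapC t : continuous (gap t).
  move=> p; apply: (@continuous_comp _ _ _
    (fun p : X * X => f (act t p.1) - f (act t p.2)) (fun a => `|a|)); last first.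
    exact: norm_continuous.
  have fact x : {for x, continuous (fun x => f (act t x))}.
    apply: (@continuous_comp _ _ _ (act t) f); last exact: fC.
    exact: continuous_act_point.
  apply: (@continuousB _ R _ (fun p : X * X => f (act t p.1))
                             (fun p : X * X => f (act t p.2))).
    apply: (@continuous_comp _ _ _ (fst : X * X -> X) (fun x => f (act t x))).
      exact: cvg_fst.
    exact: fact.
  apply: (@continuous_comp _ _ _ (snd : X * X -> X) (fun x => f (act t x))).
    exact: cvg_snd.
  exact: fact.
have : \forall m \near 0^'+, K `<=` (fun p => exists t, 2 * m < gap t p).
  apply: (cK R (0^'+) (fun m p => exists t, 2 * m < gap t p)) => p Kp.
  have [t tp] := sepf p Kp; pose c := gap t p.
  have c0 : 0 < c by rewrite /c /gap normr_gt0 subr_eq0; exact/eqP.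
  have near_p : \forall q \near p, c / 2 < gap t q.
    have : c / 2 < gap t p by rewrite -/c; lra.
    exact: (cvgr_gt _ (gapC t p)).
  have near_0 : \forall m \near 0^'+, m < c / 4.
    by apply: nbhs_right_lt; rewrite divr_gt0.
  exists ([set q | c / 2 < gap t q], [set m | m < c / 4]) => //.
  move=> [q m] /= [gap_q mc]; exists t; apply: lt_trans gap_q; lra.
move=> near_sep.
have [m [m0 sep]] : exists m : R, 0 < m /\
    K `<=` (fun p => exists t, 2 * m < gap t p).
  near (0 : R)^'+ => m; exists m; split; first by near: m; exact: nbhs_right_gt.
  by near: m.
exists m => // g fg p Kp; have [t gap_t] := sep p Kp; exists t => geq.
have := fg (act t p.1); have := fg (act t p.2).
move: gap_t; rewrite /gap ltNge => /negP + h1 h2; apply.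
have := ler_distD (g (act t p.1)) (f (act t p.1)) (f (act t p.2)).
rewrite {2}geq (distrC (g _)); lra.
Unshelve. all: by end_near. Qed.

(** In the space of admissible functions with the uniform distance, the
    functions separating [W] contain a dense set of interior points. *)
Definition robustly_separable (W : set (X * X)) : Prop :=
  forall (f : X -> R) (e : R), admissible f -> 0 < e ->
    exists (g : X -> R) (m : R),
      [/\ admissible g, forall x, `|f x - g x| <= e, 0 < m &
          forall g', (forall x, `|g x - g' x| <= m) -> separates W g'].

(** The second perturbation is kept within half of the margin left by the
    first. *)
Lemma robustly_separableU W1 W2 : robustly_separable W1 ->
  robustly_separable W2 -> robustly_separable (W1 `|` W2).
Proof.
move=> H1 H2 f e f_adm e0; have e2 : 0 < e / 2 by rewrite divr_gt0.
have [g1 [m1 [g1_adm fg1 m1_gt0 sep1]]] := H1 f _ f_adm e2.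
pose e' := Num.min (e / 2) (m1 / 2).
have e'0 : 0 < e' by rewrite lt_min e2 divr_gt0.
have [e'e e'm] : e' <= e / 2 /\ e' <= m1 / 2 by rewrite !ge_min !lexx orbT.
have [g2 [m2 [g2_adm g12 m2_gt0 sep2]]] := H2 g1 _ g1_adm e'0.
exists g2, (Num.min m2 (m1 / 2)); split => //.
- move=> x; have := fg1 x; have := g12 x; have := ler_distD (g1 x) (f x) (g2 x).
  lra.
- by rewrite lt_min m2_gt0 divr_gt0.
- move=> g' close p [W1p|W2p].
    apply: sep1 W1p => x; have := close x; rewrite le_min => /andP[_ ?].
    have := g12 x; have := ler_distD (g2 x) (g1 x) (g' x); lra.
  by apply: sep2 W2p => x; have := close x; rewrite le_min => /andP[].
Qed.

Hypothesis X_compact : compact [set: X].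

Lemma compact_ball p a : compact [set x | d p x <= a].
Proof.
apply: subclosed_compact X_compact _ => //.
apply: (@closed_comp _ _ (d p) [set x | x <= a]); last exact: closed_le.
by move=> x _; exact: continuous_dist.
Qed.

Lemma robustly_separable_near p q : ~ fixed_points act p -> p <> q ->
  exists2 W, nbhs (p, q) W & robustly_separable W.
Proof.
move=> nfp pq; have [a a0 sep] := local_separation nfp pq.
exists ([set x | d p x <= a] `*` [set y | d q y <= a]).
  exists ([set x | d p x < a], [set y | d q y < a]) => /=.
    by split; exact: nbhs_dist.
  by move=> [x y] /= [? ?]; split; exact: ltW.
move=> f e f_adm e0; have [g [g_adm fg g_sep]] := sep f e f_adm e0.
have [||m m0 mP] := @separation_margin _ g
    (compact_setX (@compact_ball p a) (@compact_ball q a)).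
- by case: g_adm.
- by move=> [x y] /= [px qy]; exact: g_sep.
by exists g, m.
Qed.

(** A compact exhaustion, as [e] decreases to [0], of the pairs of distinct
    points whose first member is not fixed. *)
Definition apart (e : R) : set (X * X) :=
  [set p | e <= d p.1 p.2 /\ forall z, fixed_points act z -> e <= d p.1 z].

Lemma compact_apart e : compact (apart e).
Proof.
have cXX : compact [set: X * X] by rewrite -setXTT; exact: compact_setX.
apply: subclosed_compact cXX _ => //.
have -> : apart e = [set p | e <= d p.1 p.2] `&`
    \bigcap_(z in fixed_points act) [set p | e <= d p.1 z].
  by apply/seteqP; split => p.
apply: closedI.
  apply: (@closed_comp _ _ (fun p : X * X => d p.1 p.2) [set x | e <= x]).
    2: exact: closed_ge.
  move=> [x y] _; apply/cvgrPdist_lt => c c0; have c2 : 0 < c / 2 by lra.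
  exists ([set x' | d x x' < c / 2], [set y' | d y y' < c / 2]) => /=.
    by split; exact: nbhs_dist.
  move=> [x' y'] /= [xx' yy'].
  have := d_tri x x' y; have := d_tri x' y' y; have := d_tri x' x y'.
  have := d_tri x y y'; rewrite (d_sym x' x) (d_sym y' y) => ? ? ? ?.
  by rewrite ltr_norml; apply/andP; split; lra.
apply: closed_bigI => z _.
apply: (@closed_comp _ _ (fun p : X * X => d p.1 z) [set x | e <= x]).
  2: exact: closed_ge.
move=> p _; apply: (@continuous_comp _ _ _ (fst : X * X -> X) (fun x => d x z)).
  exact: cvg_fst.
have -> : (fun x => d x z) = d z by apply/funext => x; exact: d_sym.
exact: continuous_dist.
Qed.

Lemma robustly_separable_apart e : 0 < e -> robustly_separable (apart e).
Proof.
move=> e0; apply: compact_induction (@compact_apart e) _ _ robustly_separableU _.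
- move=> f c f_adm c0; exists f, 1; split => // [x|? ? ? []].
  by rewrite subrr normr0 ltW.
- move=> A B AB HB f c f_adm c0; have [g [m [g_adm fg m0 sep]]] := HB f c f_adm c0.
  by exists g, m; split => // g' gg' p /AB; exact: sep.
- move=> [p q] /= [pq pz]; apply: robustly_separable_near.
    by move=> /pz; rewrite (d_eq0 p p).2 // leNgt e0.
  by move=> pqE; move: pq; rewrite pqE (d_eq0 q q).2 // leNgt e0.
Qed.

(** * The category argument *)

Lemma admissible_uniform_limit (F : nat -> X -> R) (E : nat -> R) (f : X -> R) :
  (forall n, admissible (F n)) ->
  (forall e, 0 < e -> exists n, E n <= e) ->
  (forall n x, `|F n x - f x| <= E n) -> admissible f.
Proof.
move=> F_adm E0 Ff.
have approx e : 0 < e -> exists2 n, admissible (F n) & forall x, `|F n x - f x| <= e.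
  by move=> /E0[n En]; exists n => // x; exact: le_trans (Ff n x) En.
split.
- move=> x; apply/cvgrPdist_le => e e0.
  have e3 : 0 < e / 3 by rewrite divr_gt0.
  have [n [FC _ _ _] close] := approx _ e3.
  have /cvgrPdist_le /(_ _ e3) := FC x; apply: filterS => y Fxy.
  move: Fxy (close x) (close y); rewrite !ler_norml.
  by move=> /andP[? ?] /andP[? ?] /andP[? ?]; apply/andP; split; lra.
- move=> x; apply/andP; split; apply/ler_addgt0Pr => e /approx[n [_ F01 _ _] close].
    have /andP[? ?] := F01 x; have := close x; rewrite ler_norml => /andP[? ?]; lra.
  have /andP[? ?] := F01 x; have := close x; rewrite ler_norml => /andP[? ?]; lra.
- move=> t x; apply/ler_addgt0Pr => e e0; have e2 : 0 < e / 2 by rewrite divr_gt0.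
  have [n [_ _ F_lip _] close] := approx _ e2.
  move: (F_lip t x) (close x) (close (act t x)); rewrite !ler_norml.
  by move=> /andP[? ?] /andP[? ?] /andP[? ?]; apply/andP; split; lra.
- move=> x fx; apply/eqP; rewrite -subr_eq0 -normr_le0.
  apply/ler_addgt0Pr => e /approx[n [_ _ _ F_fix] close].
  by rewrite add0r -F_fix // distrC.
Qed.

(** The [n]-th step separates [W n] with a margin [E n.+1] at most half of
    [E n] and moves the function by at most [E n / 2], so that all later
    functions, and their limit, stay within the margin. *)
Lemma separate_all (f0 : X -> R) (W : nat -> set (X * X)) : admissible f0 ->
  (forall n, robustly_separable (W n)) ->
  exists f, admissible f /\ forall n, separates (W n) f.
Proof.
move=> f0_adm W_sep.
pose state := {s : (X -> R) * R | admissible s.1 /\ 0 < s.2}.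
have step (ns : nat * state) : exists s' : state,
    [/\ forall x, `|(sval ns.2).1 x - (sval s').1 x| <= (sval ns.2).2 / 2,
        (sval s').2 <= (sval ns.2).2 / 2, (sval s').2 <= ns.1.+1%:R^-1 &
        forall g, (forall x, `|(sval s').1 x - g x| <= (sval s').2) ->
          separates (W ns.1) g].
  case: ns => n [[f e] /= [f_adm e0]].
  have e2 : 0 < e / 2 by rewrite divr_gt0.
  have [g [m [g_adm fg m0 sep]]] := W_sep n f _ f_adm e2.
  pose e' := Num.min m (Num.min (e / 2) n.+1%:R^-1).
  have e'0 : 0 < e' by rewrite !lt_min m0 e2 invr_gt0 ltr0n.
  exists (exist _ (g, e') (conj g_adm e'0)); split => //=.
  - by rewrite !ge_min lexx !orbT.
  - by rewrite !ge_min lexx !orbT.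
  - move=> g' gg'; apply: sep => x; apply: le_trans (gg' x) _.
    by rewrite ge_min lexx.
have [next nextP] := choice step.
pose s := fix s n := if n is m.+1 then next (m, s m)
  else exist _ (f0, 1) (conj f0_adm ltr01) : state.
pose F n := (sval (s n)).1; pose E n := (sval (s n)).2.
have F_adm n : admissible (F n) by rewrite /F; case: (s n) => ? [].
have E_gt0 n : 0 < E n by rewrite /E; case: (s n) => ? [].
have Fstep n x : `|F n x - F n.+1 x| <= E n / 2.
  by have [+ _ _ _] := nextP (n, s n); exact.
have Estep n : E n.+1 <= E n / 2 by have [_ + _ _] := nextP (n, s n).
have Esmall n : E n.+1 <= n.+1%:R^-1 by have [_ _ + _] := nextP (n, s n).
have Fsep n g : (forall x, `|F n.+1 x - g x| <= E n.+1) -> separates (W n) g.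
  by have [_ _ _ +] := nextP (n, s n); exact.
have Ftail j n x : `|F n x - F (n + j)%N x| <= E n.
  elim: j n => [|j IH] n; first by rewrite addn0 subrr normr0 ltW.
  have := Fstep n x; have := IH n.+1; have := Estep n; rewrite addSnnS.
  by have := ler_distD (F n.+1 x) (F n x) (F (n + j.+1)%N x); lra.
have Fcauchy m n x : F m x - E m <= F n x + E n.
  have := E_gt0 m; have := E_gt0 n.
  have [/subnKC<-|/ltnW/subnKC<-] := leqP m n.
    have := Ftail (n - m)%N m x; rewrite ler_norml => /andP[? ?] ? ?; lra.
  have := Ftail (m - n)%N n x; rewrite ler_norml => /andP[? ?] ? ?; lra.
(* The intervals [[F n x - E n, F n x + E n]] meet pairwise, so the supremum of
   their left ends lies in all of them. *)
pose f x := sup (range (fun n => F n x - E n)).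
have Ff n x : `|F n x - f x| <= E n.
  have lower : F n x - E n <= f x.
    apply: ub_le_sup; last by exists n.
    by exists (F 0%N x + E 0%N) => _ [m _ <-].
  have upper : f x <= F n x + E n.
    apply: ge_sup => [|_ [m _ <-]]; last exact: Fcauchy.
    by exists (F n x - E n), n.
  by rewrite ler_norml; apply/andP; split; lra.
exists f; split => [|n]; last exact: (Fsep n).
apply: (admissible_uniform_limit F_adm _ Ff) => e e0.
exists (Num.truncn e^-1).+1; apply: le_trans (Esmall _) _.
by rewrite -[leRHS]invrK lef_pV2 ?posrE ?invr_gt0 ?ltr0n // ltW // truncnS_gt.
Qed.

(** Two distinct points are told apart by [h] if both are fixed; otherwise the
    pair lies, in one of its two orders, in some [apart n.+1%:R^-1]. *)
Lemma admissible_separating : continuous h -> (forall x, 0 <= h x <= 1) ->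
  (forall x y, fixed_points act x -> fixed_points act y -> h x = h y -> x = y) ->
  exists f : X -> R, admissible f /\
    forall x y, (forall t, f (act t x) = f (act t y)) -> x = y.
Proof.
move=> hC h01 h_inj.
have f0_adm : admissible (sup_conv 1 h).
  split.
  - exact: continuous_sup_conv.
  - move=> x; have /andP[h0 _] := h01 x.
    rewrite (le_trans h0 (sup_conv_above _ _ x)) //=.
    by apply: sup_conv_ub => // y; case/andP: (h01 y).
  - exact: sup_conv_lipschitz.
  - by move=> x fx; exact: sup_conv_fixed.
have [|f [f_adm f_sep]] := separate_all f0_adm (W := fun n => apart n.+1%:R^-1).
  by move=> n; apply: robustly_separable_apart; rewrite invr_gt0.
have sep x y : ~ fixed_points act x -> (forall t, f (act t x) = f (act t y)) ->
    x = y.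
  move=> nfx fxy; apply: contrapT => xy.
  have [e e0 eP] := nonfixed_dist nfx.
  pose c := Num.min e (d x y).
  have c0 : 0 < c by rewrite lt_min e0 dist_gt0.
  pose n := Num.truncn c^-1.
  have nc : n.+1%:R^-1 <= c.
    by rewrite -[leRHS]invrK lef_pV2 ?posrE ?invr_gt0 ?ltr0n // ltW // truncnS_gt.
  have [|t] := f_sep n (x, y); last by rewrite /= fxy.
  split=> /= [|z /eP ez]; apply: le_trans nc _; first by rewrite ge_min lexx orbT.
  by rewrite ge_min ez.
exists f; split => // x y fxy.
have [fx|nfx] := pselect (fixed_points act x); last exact: sep.
have [fy|nfy] := pselect (fixed_points act y).
  by apply: h_inj => //; case: f_adm => _ _ _ fE; rewrite -!fE // -(act0 x) -(act0 y).
by apply/esym/sep => // t; rewrite fxy.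
Qed.

Lemma closed_fixed_points : closed (fixed_points act).
Proof.
move=> p clp; apply: contrapT => nfp; have [e e0 eP] := nonfixed_dist nfp.
have [z [fz /= pz]] := clp _ (nbhs_dist p e0).
by have := eP z fz; rewrite leNgt pz.
Qed.

Lemma metric_hausdorff : hausdorff_space X.
Proof.
move=> p q pq; apply: contrapT => neq; have e0 := dist_gt0 neq.
have e2 : 0 < d p q / 2 by rewrite divr_gt0.
have [z [/= pz qz]] := pq _ _ (nbhs_dist p e2) (nbhs_dist q e2).
by have := d_tri p z q; rewrite (d_sym z q); lra.
Qed.

End Metric.
End Admissible.

Lemma orbit_map_embedding (f : X -> R) :
  continuous f -> (forall x, 0 <= f x <= 1) -> orbit_lipschitz 1 f ->
  (forall x y, (forall t, f (act t x) = f (act t y)) -> x = y) ->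
  flow_embeds act (@lip_shift R k).
Proof.
move=> fC f01 f_lip f_inj.
pose orbit x : {compact-open, 'rV[R]_k -> R} := fun s => f (act s x).
have orbitP x : orbit x \in @Lip1 R k.
  apply/mem_set; split => [s|s r]; first exact: f01.
  by rewrite -[leRHS]mul1r; exact: orbit_lipschitz2.
have orbitC : continuous orbit.
  apply: (@continuous_curry_fun X 'rV[R]_k R (fun q => f (act q.2 q.1))) => q.
  apply: (@continuous_comp _ _ _ (fun q : X * 'rV[R]_k => act q.2 q.1) f);
    last exact: fC.
  exact: continuous_act_swap.
exists (fun x => exist _ (orbit x) (orbitP x)); split; first split.
- apply: continuous_comp_initial; exact: orbitC.
- move=> x y /(congr1 sval) /= xy; apply: f_inj => t.
  exact: (congr1 (fun g : 'rV[R]_k -> R => g t) xy).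
- move=> t x; apply: val_inj; apply/funext => s /=.
  by rewrite /lip_shift_fun set_valE /= /orbit actD.
Qed.

End FlowCalculus.

(** * The embedding theorem *)

(** Tietze's theorem extends the embedding of [A] to [X]; the absolute value
    and the factor [1 / 2] bring the extension into the lower half of the unit
    interval, which leaves room above it for bumps. *)
Lemma fixed_points_separating (R : realType) (X : topologicalType) (A : set X) :
  hausdorff_space X -> compact [set: X] -> closed A ->
  embeds_topologically (set_type A) (set_type (`[0, 1] : set R)) ->
  exists h : X -> R, [/\ continuous h, forall x, 0 <= h x <= 2^-1 &
    forall x y, A x -> A y -> h x = h y -> x = y].
Proof.
move=> hX cX clA [j [jC j_inj]].
pose h0 x : R :=
  if pselect (A x) is left Ax then \val (j (exist _ x (mem_set Ax))) else 0.
have h0E x (Ax : A x) : h0 x = \val (j (exist _ x (mem_set Ax))).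
  rewrite /h0; case: pselect => // Ax'.
  by congr (\val (j _)); exact: val_inj.
have h0_01 x : 0 <= h0 x <= 1.
  rewrite /h0; case: pselect => [Ax|_]; last by rewrite lexx ler01.
  by have := set_valP (j (exist _ x (mem_set Ax))); rewrite /= in_itv.
have h0C : {within A, continuous h0}.
  apply/subspace_sigL_continuousP.
  have -> : sigL A h0 = \val \o j.
    apply/funext => -[x Ax]; rewrite /sigL /= set_valE /= (h0E x (set_mem Ax)).
    by congr (\val (j _)); exact: val_inj.
  move=> x; apply: continuous_comp; first exact: jC.
  exact: initial_continuous.
have [|g [gE gC g1]] := continuous_bounded_extension (compact_normal hX cX) clA
    (ltr01 : 0 < 1 :> R) h0C.
  by move=> x _; have /andP[? ?] := h0_01 x; rewrite ger0_norm.
exists (fun x => `|g x| / 2); split.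
- move=> x; apply: (@continuousM _ _ (fun x => `|g x|) (cst 2^-1)); last first.
    exact: cst_continuous.
  apply: (@continuous_comp _ _ _ g (fun a : R => `|a|)); first exact: gC.
  exact: norm_continuous.
- by move=> x; rewrite divr_ge0 //= ler_pdivrMr // mulVf.
- move=> x y Ax Ay.
  have gA z : A z -> `|g z| = h0 z.
    by move=> Az; rewrite -gE ?inE // ger0_norm //; case/andP: (h0_01 z).
  have two0 : 2 != 0 :> R by rewrite pnatr_eq0.
  rewrite !gA // => /(divIf two0).
  by rewrite (h0E x Ax) (h0E y Ay) => /val_inj/j_inj/(congr1 sval).
Qed.

Theorem theorem1p5 (R : realType) (k : nat) (hk : (1 <= k)%N)
    (X : topologicalType) (act : 'rV[R]_k -> X -> X) :
  multidimensional_flow act ->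
  embeds_topologically (set_type (fixed_points act)) (set_type (`[0, 1] : set R)) ->
  weakly_locally_free act ->
  flow_embeds act (@lip_shift R k).
Proof.
move=> [cX [d [d0 d_sym d_tri d_nbhs]] actC act0 actD] fix_embeds _.
have d_ge0 x y : 0 <= d x y by case: (d0 x y).
have d_eq0 x y : d x y = 0 <-> x = y by case: (d0 x y).
have hX := metric_hausdorff d_ge0 d_eq0 d_sym d_tri d_nbhs.
have clfix := closed_fixed_points actC d_ge0 d_eq0 d_sym d_tri d_nbhs.
have [h [hC h01 h_inj]] := fixed_points_separating hX cX clfix fix_embeds.
have h_le x : fixed_points act x -> h x <= 2^-1 by case/andP: (h01 x).
have [|f [[fC f01 f_lip _] f_inj]] := admissible_separating actC act0 actD h_le
    d_ge0 d_eq0 d_sym d_tri d_nbhs cX hC _ h_inj.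
  by move=> x; have /andP[-> ?] := h01 x; rewrite /=; lra.
exact: orbit_map_embedding f_inj.
Qed.
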